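(* Let $\Omega\subset\mathbb{R}^d$ be a bounded open set with Lipschitz boundary. Let $a_{i,j},c\in L^\infty(\Omega)$ ($i,j=1,\dots,d$) with $a_{i,j}=a_{j,i}$ a.e., $c\ge0$ a.e., and suppose there are $0<\alpha\le\beta<\infty$ with $\alpha|\xi|^2\le\sum_{i,j=1}^da_{i,j}(x)\xi_i\xi_j\le\beta|\xi|^2$ for a.e. $x\in\Omega$ and all $\xi\in\mathbb{R}^d$. Let $\gamma>0$ and define $F_L:H_0^1(\Omega)\to\mathbb{R}$ by $$F_L(u)=\frac12\int_\Omega\sum_{i,j=1}^da_{i,j}\,\partial_ju\,\partial_iu\,dx+\frac12\int_\Omega c|u|^2dx+\frac\gamma2\int_\Omega|u|^2dx-\gamma\Big(\int_\Omega|u|^2dx\Big)^{1/2}.$$ Then any local minimizer of $F_L$ in $H_0^1(\Omega)$ is a global minimizer of $F_L$ over $H_0^1(\Omega)$.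
   Context: $H_0^1(\Omega)$ is the usual Sobolev space with its norm topology (used for ''local minimizer''). *)

(* Defs.v *)
From HB Require Import structures.
From mathcomp Require Import all_boot all_order all_algebra.
From mathcomp Require Import all_classical all_reals all_analysis.

Set Implicit Arguments.
Unset Strict Implicit.
Unset Printing Implicit Defensive.
Import Order.TTheory GRing.Theory Num.Theory.
Import numFieldNormedType.Exports.
Local Open Scope classical_set_scope.
Local Open Scope ring_scope.

(* Throughout, R^d is 'rV[R]_d with d = n.+1, so that d ranges over all
   positive integers. *)

Section lebesgue_outer_measure.
Context (R : realType) (n : nat).
Local Notation V := 'rV[R]_n.+1.

Definition obox (B : V * V) : set V :=
  [set x | forall i, B.1 ord0 i < x ord0 i <= B.2 ord0 i].

Definition obox_volume (B : V * V) : R :=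
  \prod_(i < n.+1) (B.2 ord0 i - B.1 ord0 i).

Definition obox_cover (A : set V) : set (nat -> V * V) :=
  [set B : nat -> V * V | (forall k i, (B k).1 ord0 i <= (B k).2 ord0 i) /\
           A `<=` \bigcup_k obox (B k)].

Definition lebesgue_outer (A : set V) : \bar R :=
  ereal_inf [set (\sum_(k <oo) (obox_volume (B k))%:E)%E | B in obox_cover A].

Lemma obox_cover_volume_ge0 A B k : obox_cover A B -> 0 <= obox_volume (B k).
Proof. by move=> [B0 _]; apply: prodr_ge0 => i _; rewrite subr_ge0. Qed.

Lemma lebesgue_outer_ge0 A : (0 <= lebesgue_outer A)%E.
Proof.
apply: le_ereal_inf_tmp => _ [B cB <-]; apply: nneseries_ge0 => k _ _.
by rewrite lee_fin (obox_cover_volume_ge0 _ cB).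
Qed.

Lemma lebesgue_outer0 : lebesgue_outer set0 = 0%E.
Proof.
apply/eqP; rewrite eq_le lebesgue_outer_ge0 andbT.
apply: ereal_inf_lbound; exists (fun=> (0, 0)); first by split.
rewrite eseries0// => k _ _; by rewrite /obox_volume big_ord_recl /= subrr mul0r.
Qed.

Lemma le_lebesgue_outer : {homo lebesgue_outer : A B / A `<=` B >-> (A <= B)%E}.
Proof.
move=> A B AB; apply/ereal_inf_le_tmp => _ [C [C0 CB] <-].
by exists C => //; split => //; exact: subset_trans AB CB.
Qed.

Lemma lebesgue_outer_sigma_subadditive : sigma_subadditive lebesgue_outer.
Proof.
move=> A; have [[i ioo]|] := pselect (exists i, lebesgue_outer (A i) = +oo%E).
  rewrite (eseries_pinfty _ _ ioo) ?leey// => k _.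
  by rewrite -ltNye (lt_le_trans _ (lebesgue_outer_ge0 _)).
rewrite -forallNE => Aoo.
apply/lee_addgt0Pr => e e0.
apply: le_trans (epsilon_trick _ _ (ltW e0)); last first.
  by move=> k; exact: lebesgue_outer_ge0.
pose P k (B : nat -> V * V) := obox_cover (A k) B /\
  (\sum_(j <oo) (obox_volume (B j))%:E <=
   lebesgue_outer (A k) + (e / (2 ^ k.+1)%:R)%:E)%E.
have [G PG] : {G : nat -> nat -> V * V & forall k, P k (G k)}.
  apply: (@choice _ _ P) => k.
  have Afin : lebesgue_outer (A k) \is a fin_num.
    by rewrite ge0_fin_numE ?lebesgue_outer_ge0// ltey; exact/eqP/Aoo.
  have ek : 0 < e / (2 ^ k.+1)%:R by rewrite divr_gt0// ltr0n expn_gt0.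
  have [_ [B cB <-] ltB] := lb_ereal_inf_adherent ek Afin.
  by exists B; split => //; exact: ltW.
pose vol (p : nat * nat) := (obox_volume (G p.1 p.2))%:E.
have vol0 p : (0 <= vol p)%E.
  by rewrite lee_fin (obox_cover_volume_ge0 _ (PG p.1).1).
apply: (@le_trans _ _ (\esum_(p in setT) vol p)%E).
  have /card_esym/ppcard_eqP[f] := card_nat2.
  apply: ereal_inf_lbound; exists (fun k => G (f k).1 (f k).2).
    split => [k i|x [k _ Akx]]; first exact: (PG _).1.1.
    have [j _ Gx] := (PG k).1.2 _ Akx.
    by exists (f^-1%FUN (k, j)) => //; rewrite invK ?inE.
  rewrite -[LHS]/(\sum_(k <oo) vol (f k))%E.
  rewrite -[LHS](esum_pred_image vol f xpredT)//.
    by rewrite fun_true image_eq.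
  by move=> x y _ _; apply: inj; rewrite inE.
rewrite (_ : esum _ _ = \sum_(i <oo) \sum_(j <oo) vol (i, j))%E; last first.
  pose J : nat -> set (nat * nat) := fun i => [set (i, j) | j in setT].
  rewrite (_ : setT = \bigcup_k J k); last first.
    by rewrite predeqE => -[a b]; split => // _; exists a => //; exists b.
  rewrite esum_bigcupT //=; last first.
    apply/trivIsetP => i j _ _ ij.
    rewrite predeqE => -[k m] /=; split => //= -[] [_] _ [<-{k} _].
    by move=> [m' _] [] /esym/eqP; rewrite (negbTE ij).
  rewrite -(image_id [set: nat]) -fun_true esum_pred_image//; last first.
    by move=> k _; exact: esum_ge0.
  apply: eq_eseriesr => /= j _.
  rewrite -(esum_pred_image vol (pair j) predT)//=; last first.
    by move=> ? ? _ _; exact: (@can_inj _ _ _ snd).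
  by congr esum; rewrite predeqE => -[a b]; split; move=> [i _ <-]; exists i.
by apply: lee_nneseries => [k _ _|k _]; [exact: nneseries_ge0|exact: (PG k).2].
Qed.

HB.instance Definition _ := isOuterMeasure.Build R V lebesgue_outer
  lebesgue_outer0 lebesgue_outer_ge0 le_lebesgue_outer
  lebesgue_outer_sigma_subadditive.

End lebesgue_outer_measure.

(* The d-dimensional Lebesgue measure, on the sigma-algebra of all
   Lebesgue-measurable sets. *)
Definition lebesgue_Rn (R : realType) (n : nat) :
    {measure set (caratheodory_type (@lebesgue_outer R n)) -> \bar R} :=
  OuterMeasure.sort (@lebesgue_outer R n : {outer_measure set _ -> \bar R}).

Section sobolev.
Context (R : realType) (n : nat).
Local Notation V := 'rV[R]_n.+1.
Local Notation mu := (lebesgue_Rn R n).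
Implicit Types (Omega : set V).

(* Functions on Omega are total functions on R^d whose values off Omega are
   irrelevant; f \_ Omega is the extension of f by zero. *)
Definition LpOn (p : \bar R) Omega : set (V -> R) :=
  [set f | f \_ Omega \in Lfun mu p].

Definition partial (i : 'I_n.+1) (f : V -> R) : V -> R :=
  'D_(delta_mx ord0 i) f.

Definition iter_partial (s : seq 'I_n.+1) (f : V -> R) : V -> R :=
  foldr partial f s.

Definition smooth (f : V -> R) : Prop :=
  forall s, continuous (iter_partial s f) /\
    forall x i, derivable (iter_partial s f) x (delta_mx ord0 i).

Definition test_function Omega (phi : V -> R) : Prop :=
  [/\ smooth phi,
      compact (closure [set x | phi x != 0]) &
      closure [set x | phi x != 0] `<=` Omega].

Definition weak_partial Omega (i : 'I_n.+1) (u g : V -> R) : Prop :=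
  forall phi, test_function Omega phi ->
    \int[mu]_(x in Omega) (u x * partial i phi x) =
    - \int[mu]_(x in Omega) (g x * phi x).

(* An element of H^1(Omega) is carried together with (a representative of) its
   weak gradient, which the function determines almost everywhere. *)
Record H1 Omega := MkH1 {
  H1_fun :> V -> R;
  H1_grad : 'I_n.+1 -> V -> R;
  H1_fun_L2 : LpOn 2%:E Omega H1_fun;
  H1_grad_L2 : forall i, LpOn 2%:E Omega (H1_grad i);
  H1_gradP : forall i, weak_partial Omega i H1_fun (H1_grad i) }.

Definition H1_norm Omega (u : V -> R) (Du : 'I_n.+1 -> V -> R) : R :=
  Num.sqrt (\int[mu]_(x in Omega) (u x ^+ 2) +
            \sum_(i < n.+1) \int[mu]_(x in Omega) (Du i x ^+ 2)).

Definition H1_dist Omega (u v : H1 Omega) : R :=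
  H1_norm Omega (u \- v) (fun i => H1_grad u i \- H1_grad v i).

(* The closure of C_c^infty(Omega) in H^1(Omega). *)
Definition H10 Omega : set (H1 Omega) :=
  [set u : H1 Omega | forall e : R, 0 < e -> exists2 phi, test_function Omega phi &
    H1_norm Omega (u \- phi) (fun i => H1_grad u i \- partial i phi) < e].

Definition local_minimizer Omega (F : H1 Omega -> R) (u : H1 Omega) : Prop :=
  H10 u /\ exists2 e : R, 0 < e & forall v, H10 v -> H1_dist u v < e -> F u <= F v.

Definition global_minimizer Omega (F : H1 Omega -> R) (u : H1 Omega) : Prop :=
  H10 u /\ forall v, H10 v -> F u <= F v.

(* Near each boundary point, in suitable orthonormal coordinates y = x Q, the
   set Omega is the part above the graph of a Lipschitz function of the d - 1
   coordinates of y other than the j-th. *)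
Definition lipschitz_boundary Omega : Prop :=
  forall x, (closure Omega `\` interior Omega) x ->
  exists (r : R) (Q : 'M[R]_n.+1) (j : 'I_n.+1) (h : 'rV[R]_n -> R),
    [/\ 0 < r, Q *m Q^T = 1%:M, [lipschitz h z | z in setT] &
        forall y, ball x r y ->
          Omega y <-> h (col' j (y *m Q)) < (y *m Q) ord0 j].

Definition F_L Omega (a : 'I_n.+1 -> 'I_n.+1 -> V -> R) (c : V -> R) (gamma : R)
    (u : H1 Omega) : R :=
  2^-1 * \int[mu]_(x in Omega)
    (\sum_(i < n.+1) \sum_(j < n.+1) a i j x * H1_grad u j x * H1_grad u i x)
  + 2^-1 * \int[mu]_(x in Omega) (c x * `|u x| ^+ 2)
  + gamma / 2 * \int[mu]_(x in Omega) (`|u x| ^+ 2)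
  - gamma * Num.sqrt (\int[mu]_(x in Omega) (`|u x| ^+ 2)).

End sobolev.

(* Main.v *)
Require Import Defs.
From HB Require Import structures.
From mathcomp Require Import all_boot all_order all_algebra.
From mathcomp Require Import all_classical all_reals all_analysis.
From mathcomp Require Import measurable_realfun ess_sup_inf.
From mathcomp Require Import ring lra.

Set Implicit Arguments.
Unset Strict Implicit.
Unset Printing Implicit Defensive.
Import Order.TTheory GRing.Theory Num.Theory.
Import numFieldNormedType.Exports.
Local Open Scope classical_set_scope.
Local Open Scope ring_scope.

(** Write F(u) = a(u,u)/2 + gamma/2 |u|^2 - gamma |u|, with a the nonnegative
    quadratic form of the elliptic operator and |.| the norm of L^2.  To compare
    a local minimizer u with a competitor v it is enough to look at F on the
    plane spanned by u and v, where a and |.|^2 are nonnegative quadratic forms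
    in the two coordinates ([F_L_comb]).  The claim thus reduces to a
    fact about such planes, [plane_local_min_global].

    That fact is proved as follows when |u| > 0.  Replace v by its component
    orthogonal to u, so that |su + tv|^2 = |u|^2 s^2 + |v|^2 t^2.  Minimality
    along the ray through u gives a(u,u) + gamma |u|^2 = gamma |u|.  Minimality
    along the ellipse |su + tv| = |u| through u, where only the form a varies,
    gives both a(u,v) = 0 and a(u,u) |v|^2 <= a(v,v) |u|^2: the Rayleigh quotient
    of u is minimal in the plane.  With lambda that quotient, the first identity
    reads lambda + gamma = gamma / |u|, whence for every w in the plane, with
    m = |w|,
      F(w) >= gamma m^2 / (2|u|) - gamma m
            = gamma (m - |u|)^2 / (2|u|) - gamma |u| / 2
           >= - gamma |u| / 2 = F(u).
    When |u| = 0, a vector v with |v| > 0 would decrease F to first order near u,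
    so the norm vanishes on the plane, and F is there a nonnegative form that is
    zero at u.

    The remaining work is to justify the plane picture.  Linear combinations stay
    in H^1_0 ([H1_comb], [H10_comb]) and move continuously in the H^1 distance
    ([H1_dist_small]); the coefficients of the forms are integrals that must be
    finite for the expansions to hold.  In particular test functions and their
    derivatives must be square integrable for a measure on Caratheodory-measurable
    sets, which rests on the measurability of open sets
    ([open_measurable_Rn]). *)

(** * Quadratic functionals with a norm term on a plane *)

Section plane.
Context {R : realType}.
Implicit Types A B C E F G p q s t d gamma : R.

Definition qform A B C s t := A * s ^+ 2 + B * (s * t) + C * t ^+ 2.

(** First-order optimality without derivatives: at s = - p h with h small, the
    linear term wins over the quadratic one unless p = 0. *)
Lemma linear_term_eq0 p q d : 0 < d ->
  (forall s, `|s| < d -> 0 <= p * s + q * s ^+ 2) -> p = 0.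
Proof.
move=> d0 H; apply/eqP/negPn/negP => p0.
pose h := Num.min (d / (2 * (`|p| + 1))) (1 / (2 * (`|q| + 1))).
have np := normr_ge0 p; have nq := normr_ge0 q.
have h0 : 0 < h by rewrite lt_min !divr_gt0 ?mulr_gt0 ?ltr_pwDr.
have hd : h * (2 * (`|p| + 1)) <= d.
  by rewrite -ler_pdivlMr ?mulr_gt0 ?ltr_pwDr// ge_min lexx.
have hq : h * (2 * (`|q| + 1)) <= 1.
  by rewrite -ler_pdivlMr ?mulr_gt0 ?ltr_pwDr// ge_min lexx orbT.
have /H : `|- p * h| < d by rewrite normrM normrN (gtr0_norm h0); nra.
have pp : 0 < p ^+ 2 by rewrite exprn_even_gt0.
have -> : p * (- p * h) + q * (- p * h) ^+ 2 = p ^+ 2 * h * (q * h - 1) by ring.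
have p2h : 0 < p ^+ 2 * h by rewrite mulr_gt0.
rewrite (pmulr_rge0 _ p2h) => Hq.
have := ler_norm q; nra.
Qed.

Lemma qform_small A B C e : 0 < e -> exists2 d : R, 0 < d &
  forall s t, `|s| < d -> `|t| < d -> qform A B C s t < e.
Proof.
move=> e0; pose K := `|A| + `|B| + `|C| + 1.
have K1 : 1 <= K by rewrite ler_wpDl// !addr_ge0.
exists (Num.min 1 (e / K)).
  by rewrite lt_min ltr01 divr_gt0// (lt_le_trans _ K1).
move=> s t; rewrite !lt_min !ltr_pdivlMr ?(lt_le_trans _ K1)//.
move=> /andP[s1 sK] /andP[t1 tK].
have HA : A * s ^+ 2 <= `|A| * `|s|.
  rewrite (le_trans (ler_norm _))// normrM ler_wpM2l// normrX expr2.
  by rewrite ler_piMl// ltW.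
have HB : B * (s * t) <= `|B| * `|s|.
  rewrite (le_trans (ler_norm _))// normrM ler_wpM2l// normrM.
  by rewrite ler_piMr// ltW.
have HC : C * t ^+ 2 <= `|C| * `|t|.
  rewrite (le_trans (ler_norm _))// normrM ler_wpM2l// normrX expr2.
  by rewrite ler_piMl// ltW.
have nA := normr_ge0 A; have nB := normr_ge0 B; have nC := normr_ge0 C.
have ns := normr_ge0 s; have nt := normr_ge0 t.
rewrite /qform /K in sK tK *.
have [st|st] := leP `|s| `|t|; nra.
Qed.

(** The functional F on the plane spanned by two vectors:
    A, B, C are the coefficients of the form a, and E, F, G those of the squared
    norm.  The middle coefficients B and F are twice the polar values. *)
Definition planeJ gamma A B C E F G s t :=
  2^-1 * qform A B C s t + gamma / 2 * qform E F G s t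
  - gamma * Num.sqrt (qform E F G s t).

(** Along the ray through the base point the square root is linear, so the
    functional is a quadratic polynomial in s with an interior minimum at 0. *)
Lemma radial_stationarity gamma A B C E F G d : 0 < d -> 0 <= E ->
  (forall s, `|s| < d ->
     planeJ gamma A B C E F G 1 0 <= planeJ gamma A B C E F G (1 + s) 0) ->
  A + gamma * E = gamma * Num.sqrt E.
Proof.
move=> d0 E0 H; apply/eqP; rewrite -subr_eq0; apply/eqP.
apply: (@linear_term_eq0 _ (2^-1 * (A + gamma * E)) (Num.min d 1)).
  by rewrite lt_min d0 ltr01.
move=> s; rewrite lt_min => /andP[sd s1]; have := H _ sd.
rewrite /planeJ /qform !mulr0 !expr0n/= !mulr0 !addr0 expr1n !mulr1.
rewrite (sqrtrM ((1 + s) ^+ 2) E0) sqrtr_sqr ger0_norm; last by move: s1; rewrite ltr_norml; lra.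
by rewrite -subr_ge0 => h; apply: le_trans h _; rewrite le_eqVlt; apply/orP; left; apply/eqP; field.
Qed.

(** On the ellipse of vectors with the same norm as the base point, the two norm
    terms are constant and only A s^2 + B s t + C t^2 competes.  The ellipse is
    parametrized by t, with s = sqrt (1 - G t^2 / E). *)
Lemma tangential_stationarity gamma A B C E G d : 0 < d -> 0 < E -> 0 <= G ->
  (forall s t, `|s| < d -> `|t| < d ->
     planeJ gamma A B C E 0 G 1 0 <= planeJ gamma A B C E 0 G (1 + s) t) ->
  B = 0 /\ A * G <= C * E.
Proof.
move=> d0 E0 G0 H.
have [r r0 rP] : exists2 r : R, 0 < r &
    forall t, `|t| < r -> G / E * t ^+ 2 < Num.min d (2^-1).
  have e0 : 0 < Num.min d 2^-1 by rewrite lt_min d0 invr_gt0 ltr0n.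
  have [r r0 rP] := qform_small 0 0 (G / E) e0.
  exists r => // t tr; have := rP 0 t; rewrite /qform normr0 !mul0r !add0r.
  exact.
(* D is the coefficient of t^2 left after substituting k^2 = 1 - G t^2 / E *)
pose D := C - A * G / E.
have key t : `|t| < Num.min d r -> exists2 k : R, 2^-1 <= k & 0 <= B * (k * t) + D * t ^+ 2.
  rewrite lt_min => /andP[td /rP]; rewrite lt_min => /andP[hd h2].
  set h := G / E * t ^+ 2 in hd h2.
  have h0 : 0 <= h by rewrite mulr_ge0 ?sqr_ge0// divr_ge0// ltW.
  pose k := Num.sqrt (1 - h).
  have k0 : 0 <= k by exact: sqrtr_ge0.
  have k2 : k ^+ 2 = 1 - h by rewrite sqr_sqrtr//; lra.
  have k1 : k <= 1 by rewrite expr2 in k2; nra.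
  have kh : 1 - h <= k by rewrite expr2 in k2; nra.
  exists k; first by lra.
  have : `|k - 1| < d by rewrite ler0_norm; lra.
  move=> /H/(_ td); rewrite (_ : 1 + (k - 1) = k); last by ring.
  have eqE : qform E 0 G k t = qform E 0 G 1 0.
    rewrite /qform k2 /h; field; exact: lt0r_neq0.
  rewrite /planeJ eqE lerD2r lerD2r ler_pM2l ?invr_gt0// => HA.
  rewrite -subr_ge0 in HA; apply: le_trans HA _.
  rewrite le_eqVlt; apply/orP; left; apply/eqP.
  rewrite /qform k2 /h /D; field; exact: lt0r_neq0.
have m0 : 0 < Num.min d r by rewrite lt_min d0.
have D0 : 0 <= D.
  pose t := Num.min d r / 2.
  have t0 : 0 < t by rewrite divr_gt0.
  have tm : `|t| < Num.min d r by rewrite gtr0_norm// /t; lra.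
  have [k k1 hk] := key _ tm.
  have [l l1 hl] : exists2 k : R, 2^-1 <= k & 0 <= B * (k * - t) + D * t ^+ 2.
    by have := @key (- t); rewrite normrN sqrrN; exact.
  have t2 : 0 < t ^+ 2 by rewrite exprn_gt0.
  rewrite -(pmulr_lge0 _ t2).
  have [B0|B0] := leP 0 B.
    have : 0 <= B * (l * t) by rewrite !mulr_ge0//; lra.
    by rewrite mulrN mulrN in hl; lra.
  have : 0 <= - B * (k * t) by rewrite !mulr_ge0//; lra.
  by rewrite mulNr; lra.
split.
  (* the factor k of the linear term is absorbed by k >= 1/2 and D >= 0 *)
  apply: (@linear_term_eq0 _ (2 * D) (Num.min d r)) => // t /key[k k1 hk].
  have k0 : 0 < k by lra.
  rewrite -(pmulr_rge0 _ k0).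
  have : 0 <= (2 * k - 1) * (D * t ^+ 2).
    apply: mulr_ge0; last exact: mulr_ge0 D0 (sqr_ge0 _).
    by lra.
  move=> h; have -> : k * (B * t + 2 * D * t ^+ 2) = B * (k * t) + D * t ^+ 2
    + (2 * k - 1) * (D * t ^+ 2) by ring.
  exact: addr_ge0.
by move: D0; rewrite subr_ge0 ler_pdivrMr.
Qed.

(** The two stationarity conditions bound the functional below by a quadratic
    polynomial in the norm m whose minimum is the value at the base point.  The
    competitor has arbitrary first coordinate f and second coordinate 1. *)
Lemma orthogonal_local_min_global gamma A B C E G d f :
  0 < gamma -> 0 < d -> 0 < E -> 0 <= G ->
  (forall s t, `|s| < d -> `|t| < d ->
     planeJ gamma A B C E 0 G 1 0 <= planeJ gamma A B C E 0 G (1 + s) t) ->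
  planeJ gamma A B C E 0 G 1 0 <= planeJ gamma A B C E 0 G f 1.
Proof.
move=> g0 d0 E0 G0 H.
have st : A + gamma * E = gamma * Num.sqrt E.
  apply: (@radial_stationarity gamma A B C E 0 G d) => //; first exact: ltW.
  by move=> s sd; apply: H => //; rewrite normr0.
have [B0 AC] := tangential_stationarity d0 E0 G0 H.
rewrite /planeJ {}B0 /qform !mul0r !addr0 !expr1n expr0n/= !mulr0 !addr0 !mulr1.
have N2 : Num.sqrt E ^+ 2 = E by rewrite sqr_sqrtr// ltW.
have Ng0 : 0 < Num.sqrt E by rewrite sqrtr_gt0.
set N := Num.sqrt E in st N2 Ng0 *.
have M0 : 0 <= E * f ^+ 2 + G by rewrite addr_ge0// mulr_ge0 ?sqr_ge0// ltW.
have m2 := sqr_sqrtr M0; set m := Num.sqrt _ in m2 *.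
rewrite -[in leRHS]m2.
have A_E : A = gamma * N - gamma * N ^+ 2 by rewrite N2 -st; ring.
(* gamma / N - gamma = A / E is the Rayleigh quotient of the base point *)
have le1 : (gamma / N - gamma) * m ^+ 2 <= A * f ^+ 2 + C.
  rewrite m2 -(ler_pM2r E0).
  have -> : (gamma / N - gamma) * (E * f ^+ 2 + G) * E = A * f ^+ 2 * E + A * G.
    by rewrite A_E -N2; field; exact: lt0r_neq0.
  by rewrite mulrDl lerD2l.
rewrite -[in leLHS]N2 [in leLHS]A_E.
apply: (@le_trans _ _ (2^-1 * ((gamma / N - gamma) * m ^+ 2) +
    gamma / 2 * m ^+ 2 - gamma * m)); last by lra.
rewrite -subr_ge0 (_ : _ - _ = gamma / (2 * N) * (m - N) ^+ 2); last first.
  by field; exact: lt0r_neq0.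
by rewrite mulr_ge0 ?sqr_ge0// divr_ge0 ?mulr_ge0 ?ltW.
Qed.

(** A base point of norm zero is a minimizer only if the other vector has norm
    zero too: otherwise the term - gamma |t| sqrt G dominates near t = 0.
    A form that is nonnegative and vanishes at the base point has no mixed term; for
    the form a this uses A = 0, which is radial stationarity. *)
Lemma null_local_min_global gamma A B C F G d :
  0 < gamma -> 0 < d -> (forall s t, 0 <= qform A B C s t) ->
  (forall s t, 0 <= qform 0 F G s t) ->
  (forall s t, `|s| < d -> `|t| < d ->
     planeJ gamma A B C 0 F G 1 0 <= planeJ gamma A B C 0 F G (1 + s) t) ->
  planeJ gamma A B C 0 F G 1 0 <= planeJ gamma A B C 0 F G 0 1.
Proof.
move=> g0 d0 PA PE H.
have F0 : F = 0.
  apply/eqP/negPn/negP => F0; have := PE (- (G + 1) / F) 1.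
  rewrite /qform mul0r add0r !mulr1 expr1n mulr1.
  have -> : F * (- (G + 1) / F) + G = -1 by field.
  by lra.
have G0 : 0 <= G by have := PE 0 1; rewrite /qform F0; lra.
have JE s t : planeJ gamma A B C 0 F G s t =
    2^-1 * qform A B C s t + gamma / 2 * (G * t ^+ 2) - gamma * (Num.sqrt G * `|t|).
  by rewrite /planeJ {2 3}/qform F0 !mul0r !add0r sqrtrM// sqrtr_sqr.
have A0 : A = 0.
  have : A + gamma * 0 = gamma * Num.sqrt 0.
    apply: (@radial_stationarity gamma A B C 0 F G d) => //.
    by move=> s sd; apply: H => //; rewrite normr0.
  by rewrite sqrtr0 !mulr0 addr0.
have B0 : B = 0.
  apply/eqP/negPn/negP => nB; have := PA (- (C + 1) / B) 1.
  rewrite /qform A0 mul0r add0r !mulr1 expr1n mulr1.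
  have -> : B * (- (C + 1) / B) + C = -1 by field.
  by lra.
have Gn : gamma * Num.sqrt G = 0.
  apply: (@linear_term_eq0 _ (2^-1 * C + gamma / 2 * G) d) => // t td.
  have := @H 0 t; rewrite normr0 => /(_ d0 td).
  rewrite !JE /qform A0 B0 normr0 => h.
  have h1 : 0 <= gamma * Num.sqrt G by rewrite mulr_ge0 ?sqrtr_ge0 ?ltW.
  have := ler_wpM2l h1 (ler_norm (- t)); rewrite normrN; lra.
have /eqP : gamma * Num.sqrt G = 0 by [].
rewrite mulf_eq0 (gt_eqF g0)/= => /eqP Gn0.
rewrite !JE Gn0; have := PA 0 1; rewrite /qform A0 B0; nra.
Qed.

(** The general case reduces to the orthogonal one by replacing the second vector
    with its component orthogonal to the first; the second vector itself then has
    coordinates (f, 1), with f the projection coefficient. *)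
Theorem plane_local_min_global gamma A B C E F G d :
  0 < gamma -> 0 < d -> (forall s t, 0 <= qform A B C s t) ->
  (forall s t, 0 <= qform E F G s t) ->
  (forall s t, `|s| < d -> `|t| < d ->
     planeJ gamma A B C E F G 1 0 <= planeJ gamma A B C E F G (1 + s) t) ->
  planeJ gamma A B C E F G 1 0 <= planeJ gamma A B C E F G 0 1.
Proof.
move=> g0 d0 PA PE H.
have [E0|nE0] := eqVneq E 0.
  by rewrite E0 in H PE *; exact: (null_local_min_global g0 d0 PA PE H).
have E0 : 0 < E by rewrite lt0r nE0; have := PE 1 0; rewrite /qform; lra.
pose f := F / (2 * E).
pose B' := B - 2 * A * f; pose C' := A * f ^+ 2 - B * f + C.
pose G' := G - F * f + E * f ^+ 2.
have chg s t : planeJ gamma A B' C' E 0 G' s t = planeJ gamma A B C E F G (s - f * t) t.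
  rewrite /planeJ.
  have -> : qform A B' C' s t = qform A B C (s - f * t) t.
    by rewrite /qform /B' /C'; ring.
  suff -> : qform E 0 G' s t = qform E F G (s - f * t) t by [].
  by rewrite /qform /G' /f; field.
have G'0 : 0 <= G'.
  by have := PE (- f) 1; rewrite /G' /qform; lra.
have := @orthogonal_local_min_global gamma A B' C' E G' (d / (1 + `|f|)) f g0.
have f1 : 0 < 1 + `|f| by rewrite ltr_pwDl.
rewrite divr_gt0// => /(_ isT E0 G'0).
rewrite !chg !mulr0 !subr0 mulr1 subrr; apply => s t.
rewrite !ltr_pdivlMr// => sd td; rewrite chg -addrA.
have fs := normr_ge0 f; have ns := normr_ge0 s; have nt := normr_ge0 t.
apply: H.
  apply: le_lt_trans (ler_normB _ _) _; rewrite normrM.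
  have [st|st] := leP `|s| `|t|; nra.
nra.
Qed.
End plane.

(** * Square-integrable functions over a measurable set *)

Section square_integrable.
Context d (T : measurableType d) (R : realType).
Variables (mu : {measure set T -> \bar R}) (D : set T) (mD : measurable D).
Implicit Types f g h k : T -> R.

Local Notation L1 f := (mu.-integrable D (EFin \o f)).

Lemma integrable_dominated f g : measurable_fun D f -> L1 g ->
  (forall x, D x -> `|f x| <= g x) -> L1 f.
Proof.
move=> mf ig fg; apply: (le_integrable mD _ _ ig).
  exact/measurable_EFinP.
by move=> x Dx /=; rewrite lee_fin (le_trans (fg _ Dx))// ler_norm.
Qed.

Lemma integrable_lin s t f g : L1 f -> L1 g -> L1 (fun x => s * f x + t * g x).
Proof.
move=> If Ig; have := integrableD mD (integrableZl mD s If) (integrableZl mD t Ig).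
exact.
Qed.

Lemma integrable_rsum (I : Type) (r : seq I) (h : I -> T -> R) :
  (forall i, L1 (h i)) -> L1 (fun x => \sum_(i <- r) h i x).
Proof.
move=> hi; have := integrable_sum mD r (P := xpredT) (fun i _ => hi i).
by apply: eq_integrable => // x _ /=; rewrite sumEFin.
Qed.

Lemma Rintegral_qform s t f g h : L1 f -> L1 g -> L1 h ->
  \int[mu]_(x in D) (f x * s ^+ 2 + g x * (s * t) + h x * t ^+ 2) =
  (\int[mu]_(x in D) f x) * s ^+ 2 + (\int[mu]_(x in D) g x) * (s * t) +
  (\int[mu]_(x in D) h x) * t ^+ 2.
Proof.
move=> If Ig Ih.
have Z r e : L1 e -> L1 (fun x => e x * r).
  move=> Ie; have := integrableZr mD r Ie; exact.
rewrite RintegralD//; [|apply: (integrableD mD (Z _ _ If) (Z _ _ Ig))|exact: Z].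
by rewrite RintegralD ?RintegralZr//; exact: Z.
Qed.

Lemma ae_imply_on (P Q : T -> Prop) : (forall x, D x -> P x -> Q x) ->
  {ae mu, forall x, D x -> P x} -> {ae mu, forall x, D x -> Q x}.
Proof. by move=> PQ; apply: filterS => x /[swap] Dx /(_ Dx); exact: PQ. Qed.

(** [Rintegral_ge0] asks for pointwise nonnegativity; here an integrable f agrees
    almost everywhere with its absolute value. *)
Lemma Rintegral_ae_ge0 f : L1 f ->
  {ae mu, forall x, D x -> 0 <= f x} -> 0 <= \int[mu]_(x in D) f x.
Proof.
move=> If f0; have mf := measurable_int mu If.
rewrite /Rintegral (@ae_eq_integral _ _ _ mu D (abse \o (EFin \o f)))//.
- by apply/fine_ge0/integral_ge0 => x _; exact: abse_ge0.
- exact: measurableT_comp.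
- by apply: filterS f0 => x h Dx /=; rewrite ger0_norm// h.
Qed.

(** Membership in L^2 over D stated through the integral of the square rather than
    through a power of it, so that pointwise inequalities apply directly. *)
Definition sqint f := measurable_fun D f /\ L1 (fun x => f x ^+ 2).

Lemma Lfun2_sqint f : f \_ D \in Lfun mu 2%:E -> sqint f.
Proof.
move=> /[dup] lf /Lfun2_integrable_sqr If; split.
  apply/(measurable_restrictT _ mD).
  by move: lf; rewrite inE => /andP[]; rewrite inE.
apply/(integrable_mkcond _ mD); move: If; apply: eq_integrable => // x _ /=.
rewrite restrict_EFin /patch /=; case: ifP => // _; exact: (congr1 EFin (expr0n _ 2)).
Qed.

Lemma sqint_mul f g : sqint f -> sqint g -> L1 (fun x => f x * g x).
Proof.
move=> [mf If] [mg Ig].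
apply: (integrable_dominated _ (integrable_lin 1 1 If Ig)).
  exact: measurable_funM.
move=> x _; rewrite normrM !mul1r -(real_normK (num_real (f x))).
rewrite -(real_normK (num_real (g x))).
have := normr_ge0 (f x); have := normr_ge0 (g x).
have := sqr_ge0 (`|f x| - `|g x|); nra.
Qed.

Lemma sqint_comb s t f g : sqint f -> sqint g -> sqint (fun x => s * f x + t * g x).
Proof.
move=> [mf If] [mg Ig].
have mfg : measurable_fun D (fun x => s * f x + t * g x).
  by apply: measurable_funD; exact: measurable_funM.
split => //.
apply: (integrable_dominated _ (integrable_lin (2 * s ^+ 2) (2 * t ^+ 2) If Ig)).
  exact: measurable_funX.
move=> x _; rewrite ger0_norm ?sqr_ge0//.
have := sqr_ge0 (s * f x - t * g x); nra.
Qed.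

(** Replaces the triangle inequality of the L^2 norm, at the cost of a factor 2
    that is harmless for density arguments. *)
Lemma Rintegral_sqr_comb_le s t f g : sqint f -> sqint g ->
  \int[mu]_(x in D) ((s * f x + t * g x) ^+ 2) <=
  2 * s ^+ 2 * \int[mu]_(x in D) (f x ^+ 2) + 2 * t ^+ 2 * \int[mu]_(x in D) (g x ^+ 2).
Proof.
move=> sf sg; have [_ If] := sf; have [_ Ig] := sg.
have Z r h : L1 h -> L1 (fun x => r * h x) by move=> Ih; have := integrableZl mD r Ih.
rewrite -!RintegralZl// -RintegralD//; [|exact: Z..].
apply: le_Rintegral => //.
- by have [] := sqint_comb s t sf sg.
- exact: integrable_lin.
- move=> x _; have := sqr_ge0 (s * f x - t * g x); nra.
Qed.

(** The L^oo norm is defined to be 0 when the whole space is null; every bound then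
    holds almost everywhere. *)
Lemma Lfuny_ae_bounded k : k \_ D \in Lfun mu +oo%E ->
  exists M : R, {ae mu, forall x, D x -> `|k x| <= M}.
Proof.
rewrite inE => /andP[_]; rewrite inE /= /finite_norm unlock /=.
case: ifPn => [muT|]; last first.
  rewrite lt0e measure_ge0 andbT negbK => /eqP mu0 _; exists 0.
  by exists setT; split.
move=> sk; have [r sr] : exists r : R, (ess_sup mu (abse \o (EFin \o k \_ D)) <= r%:E)%E.
  move: sk; case: ess_sup => [r _|//|_]; first by exists r.
  by exists 0; rewrite leNye.
exists r; move/ess_supP : sr; apply: filterS => x /= + Dx.
by rewrite lee_fin patchE mem_set.
Qed.

Lemma integrable_Lfuny_mul k f : k \_ D \in Lfun mu +oo%E -> L1 f ->
  L1 (fun x => k x * f x).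
Proof.
move=> Lk If; have [M kM] := Lfuny_ae_bounded Lk.
have mk : measurable_fun D k.
  apply/(measurable_restrictT _ mD).
  by move: Lk; rewrite inE => /andP[]; rewrite inE.
have mf : measurable_fun D f by exact/measurable_EFinP/(measurable_int mu If).
have mkf : measurable_fun D (fun x => k x * f x) by exact: measurable_funM.
apply/integrableP; split; first exact/measurable_EFinP.
have /integrableP[mMf] := integrableZl mD M If.
apply: le_lt_trans; apply: ae_ge0_le_integral => //.
- by apply: measurableT_comp => //; exact/measurable_EFinP.
- exact: measurableT_comp.
- apply: filterS kM => x + Dx => /(_ Dx) kM.
  rewrite lee_fin !normrM ler_wpM2r// (le_trans kM)// ler_norm.
  done.
Qed.

End square_integrable.

(** * Lebesgue measurability of open sets in R^d *)

Section lebesgue_open.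
Context (R : realType) (n : nat).
Local Notation V := 'rV[R]_n.+1.
Local Notation mu := (lebesgue_Rn R n).
Local Notation lam := (@lebesgue_outer R n).

Definition set_coord (i : 'I_n.+1) (m : R) (b : V) : V :=
  \row_j (if j == i then m else b ord0 j).

(** The point where the hyperplane x_i = c cuts the i-th side of the box, clamped to
    that side, so that both halves are genuine boxes, possibly empty. *)
Definition cut (i : 'I_n.+1) (c : R) (B : V * V) : R :=
  Num.max (B.1 ord0 i) (Num.min c (B.2 ord0 i)).

Definition lower_half i c (B : V * V) : V * V := (B.1, set_coord i (cut i c B) B.2).
Definition upper_half i c (B : V * V) : V * V := (set_coord i (cut i c B) B.1, B.2).

Lemma obox_volume_halves i c B :
  obox_volume B = obox_volume (lower_half i c B) + obox_volume (upper_half i c B).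
Proof.
rewrite /obox_volume (bigD1 i)//= [in RHS](bigD1 i)//= [X in _ = _ + X](bigD1 i)//=.
rewrite !mxE eqxx; set P := \prod_(j < _ | _) _.
have -> : \prod_(j < n.+1 | j != i) (set_coord i (cut i c B) B.2 ord0 j - B.1 ord0 j) = P.
  by apply: eq_bigr => j /negbTE ji; rewrite !mxE ji.
have -> : \prod_(j < n.+1 | j != i) (B.2 ord0 j - set_coord i (cut i c B) B.1 ord0 j) = P.
  by apply: eq_bigr => j /negbTE ji; rewrite !mxE ji.
by ring.
Qed.

(** Caratheodory's criterion: cutting every box of a cover along the hyperplane
    gives covers of the two parts with the same total volume. *)
Lemma halfspace_measurable (i : 'I_n.+1) (c : R) :
  lam.-cara.-measurable [set x : V | x ord0 i <= c].
Proof.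
apply: le_caratheodory_measurable => X.
apply: le_ereal_inf_tmp => _ [B [B0 XB] <-].
have cutP k : (B k).1 ord0 i <= cut i c (B k) <= (B k).2 ord0 i.
  by rewrite le_max lexx ge_max B0 ge_min lexx orbT.
have cL : obox_cover (X `&` [set x | x ord0 i <= c]) (fun k => lower_half i c (B k)).
  split => [k j|x [/XB[k _ Bx] xc]] /=.
    by rewrite mxE; case: eqP => [->|_]; [case/andP: (cutP k)|exact: B0].
  exists k => // j; have /andP[Bj1 Bj2] := Bx j; rewrite /= mxE Bj1.
  case: eqP => [ji|//]; rewrite ji in Bj2 *.
  by rewrite le_max le_min xc Bj2 orbT.
have cU : obox_cover (X `&` ~` [set x | x ord0 i <= c]) (fun k => upper_half i c (B k)).
  split => [k j|x [/XB[k _ Bx] /negP xc]] /=.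
    by rewrite mxE; case: eqP => [->|_]; [case/andP: (cutP k)|exact: B0].
  exists k => // j; have /andP[Bj1 Bj2] := Bx j; rewrite /= mxE Bj2 andbT.
  case: eqP => [ji|//]; rewrite ji in Bj1 *.
  by rewrite gt_max Bj1 gt_min ltNge xc.
rewrite (eq_eseriesr (g := fun k => ((obox_volume (lower_half i c (B k)))%:E +
    (obox_volume (upper_half i c (B k)))%:E)%E)); last first.
  by move=> k _; rewrite -EFinD -obox_volume_halves.
rewrite nneseriesD.
- by apply: leeD; apply: ereal_inf_lbound; [exists (fun k => lower_half i c (B k))
    |exists (fun k => upper_half i c (B k))].
- by move=> k _ _; rewrite lee_fin (obox_cover_volume_ge0 _ cL).
- by move=> k _ _; rewrite lee_fin (obox_cover_volume_ge0 _ cU).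
Qed.

Lemma obox_measurable (a b : V) : lam.-cara.-measurable (obox (a, b)).
Proof.
rewrite (_ : obox (a, b) = \bigcap_(i in [set: 'I_n.+1])
   ([set x : V | x ord0 i <= b ord0 i] `\` [set x : V | x ord0 i <= a ord0 i])).
  apply: fin_bigcap_measurable => // i _.
  by apply: measurableD; exact: halfspace_measurable.
apply/seteqP; split => x /=.
  by move=> h i _; have /andP[ai bi] := h i; split=> //=; apply/negP; rewrite -ltNge.
by move=> h i; have [/= -> /negP] := h i Logic.I; rewrite -ltNge => ->.
Qed.

(** An open set is the countable union of the half-open boxes with rational corners
    that it contains. *)
Lemma open_measurable_Rn (U : set V) : open U -> lam.-cara.-measurable U.
Proof.
move=> oU.
pose Q (p : 'rV[rat]_n.+1 * 'rV[rat]_n.+1) : set V :=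
  obox (map_mx ratr p.1, map_mx ratr p.2).
rewrite (_ : U = \bigcup_p (if `[< Q p `<=` U >] then Q p else set0)).
  apply: countable_bigcupT_measurable => // p.
  case: ifP => _; [exact: obox_measurable|exact: measurable0].
apply/seteqP; split => [x Ux|x [p _]]; last by case: asboolP => // + Qx; exact.
have /nbhs_ballP[e /= e0 eU] : nbhs x U by exact: open_nbhs_nbhs.
have lo i : {q : rat | x ord0 i - e < ratr q < x ord0 i}.
  apply: cid; have [|q] := @rat_in_itvoo R (x ord0 i - e) (x ord0 i); first by lra.
  by rewrite in_itv /= => ?; exists q.
have hi i : {q : rat | x ord0 i < ratr q < x ord0 i + e}.
  apply: cid; have [|q] := @rat_in_itvoo R (x ord0 i) (x ord0 i + e); first by lra.
  by rewrite in_itv /= => ?; exists q.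
pose p := (\row_i sval (lo i), \row_i sval (hi i)).
exists p => //.
have -> : `[< Q p `<=` U >].
  apply/asboolP => y Qy; apply: eU; split => // i j; rewrite ord1.
  have := Qy j; rewrite /= !mxE.
  case: (lo j) (hi j) => [q /= /andP[q1 q2]] [r /= /andP[r1 r2]] /andP[h1 h2].
  by rewrite /ball /= ltr_norml; apply/andP; split; lra.
move=> i; rewrite /= !mxE; case: (lo i) (hi i) => [q /= /andP[q1 q2]] [r /= /andP[r1 r2]].
by rewrite q2 ltW.
Qed.

Lemma bounded_set_finite_measure (K : set V) : bounded_set K -> (lam K < +oo)%E.
Proof.
move=> [M0 [_ /(_ (M0 + 1))]]; rewrite ltrDl ltr01 => /(_ isT) /=.
set M := M0 + 1 => KM.
pose b : V := const_mx (`|M| + 1).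
have K_b x : K x -> obox (- b, b) x.
  move=> /KM xM i /=; rewrite !mxE.
  have : `|x ord0 i| <= M.
    apply: le_trans xM; rewrite /Num.norm /= mx_normrE.
    exact: (@le_bigmax _ _ _ _ (fun ij : 'I_1 * 'I_n.+1 => `|x ij.1 ij.2|) (ord0, i)).
  rewrite ler_norml => /andP[h1 h2]; have := ler_norm M.
  by move=> hM; apply/andP; split; lra.
(* a single box, completed by empty ones to a sequence *)
pose B (k : nat) : V * V := if k == 0%N then (- b, b) else (0, 0).
have cB : obox_cover K B.
  split=> [[|k] i|x /K_b Kx]; rewrite /B /=; last by exists 0%N.
    by rewrite !mxE; have := normr_ge0 M; lra.
  by [].
apply: (@le_lt_trans _ _ (\sum_(k <oo) (obox_volume (B k))%:E)%E).
  by apply: ereal_inf_lbound; exists B.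
rewrite nneseries_recl//; last first.
  by move=> k _; rewrite lee_fin (obox_cover_volume_ge0 _ cB).
rewrite eseries0 ?adde0 ?ltry// => -[//|k] _ _.
by rewrite /B /= /obox_volume big_ord_recl /= subrr mul0r.
Qed.

Lemma continuous_measurable_Rn (D : set V) (f : V -> R) : lam.-cara.-measurable D ->
  continuous f -> measurable_fun (D : set (caratheodory_type lam)) f.
Proof.
move=> mD cf; apply: measurable_funTS.
apply: (measurability _ (RGenOInfty.measurableE R)) => //.
move=> _ [_ [c ->] <-]; rewrite setTI; apply: open_measurable_Rn.
by apply: open_comp => // x _; exact: cf.
Qed.
End lebesgue_open.

(** * Test functions *)

Section test_functions.
Context (R : realType) (n : nat).
Local Notation V := 'rV[R]_n.+1.
Local Notation mu := (lebesgue_Rn R n).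
Local Notation lam := (@lebesgue_outer R n).
Implicit Types (phi psi : V -> R) (Omega : set V).

Lemma iter_partial_comb a b phi psi : smooth phi -> smooth psi -> forall s,
  iter_partial s (fun x => a * phi x + b * psi x) =
  (fun x => a * iter_partial s phi x + b * iter_partial s psi x).
Proof.
move=> sphi spsi; elim => [//|i s IH]; rewrite /= {}IH.
apply/funext => x; rewrite /partial.
have [_ /(_ x i) dphi] := sphi s; have [_ /(_ x i) dpsi] := spsi s.
have := deriveD (@derivableZ _ _ R^o _ a _ _ dphi) (@derivableZ _ _ R^o _ b _ _ dpsi).
by rewrite (@deriveZ _ _ R^o _ a _ _ dphi) (@deriveZ _ _ R^o _ b _ _ dpsi).
Qed.

Lemma partial_comb a b phi psi i : smooth phi -> smooth psi ->
  partial i (fun x => a * phi x + b * psi x) =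
  (fun x => a * partial i phi x + b * partial i psi x).
Proof. by move=> sphi spsi; exact: (iter_partial_comb a b sphi spsi [:: i]). Qed.

Lemma test_function_comb a b Omega phi psi : test_function Omega phi ->
  test_function Omega psi -> test_function Omega (fun x => a * phi x + b * psi x).
Proof.
move=> [sphi cphi Ophi] [spsi cpsi Opsi].
have supp : closure [set x | a * phi x + b * psi x != 0] `<=`
    closure [set x | phi x != 0] `|` closure [set x | psi x != 0].
  rewrite -closureU; apply: closureS => x /=; have [->|p0 _] := eqVneq (phi x) 0.
    by rewrite mulr0 add0r mulf_eq0 negb_or => /andP[_]; right.
  by left.
split.
- move=> s; rewrite iter_partial_comb//.
  have [cs ds] := sphi s; have [cs' ds'] := spsi s; split.
    move=> x; apply: (@continuousD _ R^o _ (fun x => a * iter_partial s phi x)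
      (fun x => b * iter_partial s psi x)).
      by apply: continuousM; [exact: cst_continuous|exact: cs].
    by apply: continuousM; [exact: cst_continuous|exact: cs'].
  move=> x i; apply: (@derivableD _ _ R^o (fun x => a * iter_partial s phi x)
      (fun x => b * iter_partial s psi x)).
    exact: (@derivableZ _ _ R^o (iter_partial s phi)).
  exact: (@derivableZ _ _ R^o (iter_partial s psi)).
- apply: subclosed_compact supp; first exact: closed_closure.
  exact: compactU.
- by move=> x /supp[/Ophi|/Opsi].
Qed.

(** The square is bounded on a compact set of finite measure and zero elsewhere. *)
Lemma compact_support_sqint (D K : set V) phi :
  lam.-cara.-measurable D -> closed K -> compact K ->
  continuous phi -> (forall x, ~ K x -> phi x = 0) -> sqint mu D phi.
Proof.
move=> mD clK cK cphi phi0.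
have mK : lam.-cara.-measurable K.
  by rewrite -[K]setCK; apply: measurableC; apply: open_measurable_Rn; rewrite openC.
have mphi2 E : lam.-cara.-measurable E ->
    measurable_fun (E : set (caratheodory_type _)) (fun x => phi x ^+ 2).
  by move=> mE; apply: measurable_funX; exact: continuous_measurable_Rn.
split; first exact: continuous_measurable_Rn.
have IK : mu.-integrable K (EFin \o (fun x => phi x ^+ 2)).
  apply: (measurable_bounded_integrable mK _ (mphi2 _ mK)).
    by apply: bounded_set_finite_measure; exact: compact_bounded.
  have /compact_bounded[M [Mr hM]] : compact (phi @` K).
    by apply: continuous_compact => //; exact: continuous_subspaceT.
  exists (`|M + 1| ^+ 2); split; first exact: num_real.
  move=> r Mr2 x Kx /=; rewrite (le_trans _ (ltW Mr2))// normrX.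
  rewrite ler_sqr ?nnegrE//; apply: (le_trans _ (ler_norm _)).
  by apply: hM; [rewrite ltrDl|exists x].
apply: (integrableS measurableT mD (@subsetT _ _)).
move/(integrable_mkcond _ mK) : IK; apply: eq_integrable => // x _ /=.
rewrite patchE; case: ifPn => // /negP; rewrite inE => /phi0 ->.
by rewrite expr0n.
Qed.

Lemma partial_off_support phi i x : ~ closure [set x | phi x != 0] x ->
  partial i phi x = 0.
Proof.
move=> Kx; rewrite /partial -(derive_cst (0 : R^o) x (delta_mx ord0 i)).
apply: near_eq_derive.
have : nbhs x (~` closure [set x | phi x != 0]).
  by apply: open_nbhs_nbhs; split => //; rewrite openC; exact: closed_closure.
apply: filterS => y; apply: contra_notP => /eqP y0; exact: subset_closure.
Qed.

(** Makes the integrals in the definitions of weak derivatives and of H^1 distances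
    to test functions finite, hence linear in the integrand. *)
Lemma test_function_sqint (D Omega : set V) phi :
  lam.-cara.-measurable D -> test_function Omega phi ->
  sqint mu D phi /\ forall i, sqint mu D (partial i phi).
Proof.
move=> mD [sphi cphi _]; have cl := @closed_closure _ [set x | phi x != 0].
split=> [|i]; apply: (compact_support_sqint mD cl cphi).
- by have [] := sphi [::].
- by move=> x; apply: contra_notP => /eqP px; exact: subset_closure.
- by have [] := sphi [:: i].
- by move=> x; exact: partial_off_support.
Qed.

End test_functions.

(** * Linear combinations in H^1 and in the closure of the test functions *)

Section sobolev_space.
Context (R : realType) (n : nat).
Local Notation V := 'rV[R]_n.+1.
Local Notation mu := (lebesgue_Rn R n).
Local Notation lam := (@lebesgue_outer R n).
Variables (Omega : set V).
Hypothesis mO : lam.-cara.-measurable Omega.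
Implicit Types (u v w : H1 Omega) (s t : R).

Lemma LpOn2_comb s t (f g : V -> R) : LpOn 2%:E Omega f -> LpOn 2%:E Omega g ->
  LpOn 2%:E Omega (fun x => s * f x + t * g x).
Proof.
rewrite /LpOn /= => lf lg.
have [c0 cl] := @Lfun_submod_closed _ _ _ mu 2%:E (lee1n 2).
have ltg : t *: (g \_ Omega) \in Lfun mu 2%:E by rewrite -[_ *: _]addr0; exact: cl.
suff -> : (fun x => s * f x + t * g x) \_ Omega = s *: (f \_ Omega) + t *: (g \_ Omega).
  exact: cl.
apply/funext => x; rewrite -[RHS]/(s * (f \_ Omega) x + t * (g \_ Omega) x) !patchE.
by case: ifP => // _; rewrite -[point]/(0 : R) !mulr0 addr0.
Qed.

Lemma H1_sqint u : sqint mu Omega u.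
Proof. exact/Lfun2_sqint/H1_fun_L2. Qed.

Lemma H1_grad_sqint u i : sqint mu Omega (H1_grad u i).
Proof. exact/Lfun2_sqint/H1_grad_L2. Qed.

Lemma weak_partial_comb s t u v i : weak_partial Omega i
  (fun x => s * u x + t * v x) (fun x => s * H1_grad u i x + t * H1_grad v i x).
Proof.
move=> phi tphi; have [sq sqp] := test_function_sqint mO tphi.
have lin (f g h : V -> R) : sqint mu Omega f -> sqint mu Omega g -> sqint mu Omega h ->
  \int[mu]_(x in Omega) ((s * f x + t * g x) * h x) =
  s * \int[mu]_(x in Omega) (f x * h x) + t * \int[mu]_(x in Omega) (g x * h x).
  move=> sf sg sh; have Ifh := sqint_mul mO sf sh; have Igh := sqint_mul mO sg sh.
  rewrite -!RintegralZl// -RintegralD//; last 2 first.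
    exact: (integrableZl mO s Ifh).
    exact: (integrableZl mO t Igh).
  by apply: eq_Rintegral => x _; ring.
rewrite !lin//; try exact: H1_sqint; try exact: H1_grad_sqint.
by rewrite !(H1_gradP _ _ tphi); ring.
Qed.

Definition H1_comb s t u v : H1 Omega :=
  @MkH1 R n Omega (fun x => s * u x + t * v x)
    (fun i x => s * H1_grad u i x + t * H1_grad v i x)
    (LpOn2_comb s t (H1_fun_L2 u) (H1_fun_L2 v))
    (fun i => LpOn2_comb s t (H1_grad_L2 u i) (H1_grad_L2 v i))
    (weak_partial_comb s t u v).

Definition H1_sqnorm (f : V -> R) (g : 'I_n.+1 -> V -> R) : R :=
  \int[mu]_(x in Omega) (f x ^+ 2) + \sum_(i < n.+1) \int[mu]_(x in Omega) (g i x ^+ 2).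

(** Squared norms add up and scale without square roots. *)
Lemma H1_norm_ltE f g (e : R) : 0 < e ->
  (H1_norm Omega f g < e) = (H1_sqnorm f g < e ^+ 2).
Proof.
move=> e0; rewrite /H1_norm -/(H1_sqnorm f g).
have N0 : 0 <= H1_sqnorm f g.
  by rewrite addr_ge0 ?sumr_ge0// => *; apply: Rintegral_ge0 => *; exact: sqr_ge0.
by rewrite -(ltr_sqr (sqrtr_ge0 _) (ltW e0)) sqr_sqrtr.
Qed.

(** Chooses how closely u and v must be approximated for the combination of the
    approximations to be within e of s u + t v. *)
Lemma H10_comb_bound s t e (x y : R) : 0 < e ->
  let h := e / (1 + 2 * `|s| + 2 * `|t|) in x < h ^+ 2 -> y < h ^+ 2 ->
  2 * s ^+ 2 * x + 2 * t ^+ 2 * y < e ^+ 2.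
Proof.
move=> e0 h xh yh; have K0 : 0 < 1 + 2 * `|s| + 2 * `|t|.
  by rewrite -addrA ltr_pwDl// addr_ge0// mulr_ge0.
have h0 : 0 < h ^+ 2 by rewrite exprn_gt0// divr_gt0.
have -> : e = h * (1 + 2 * `|s| + 2 * `|t|) by rewrite divfK// gt_eqF.
rewrite -(real_normK (num_real s)) -(real_normK (num_real t)).
have := normr_ge0 s; have := normr_ge0 t; move: `|s| `|t| => a b b0 a0.
apply: (@le_lt_trans _ _ ((2 * a ^+ 2 + 2 * b ^+ 2) * h ^+ 2)).
  have a2 : 0 <= 2 * a ^+ 2 by rewrite mulr_ge0 ?sqr_ge0.
  have b2 : 0 <= 2 * b ^+ 2 by rewrite mulr_ge0 ?sqr_ge0.
  by rewrite [leRHS]mulrDl; exact: lerD (ler_wpM2l a2 (ltW xh)) (ler_wpM2l b2 (ltW yh)).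
by rewrite [ltRHS]exprMn [ltRHS]mulrC (ltr_pM2r h0); nra.
Qed.

Lemma H10_comb s t u v : H10 u -> H10 v -> H10 (H1_comb s t u v).
Proof.
move=> Hu Hv e e0.
pose h := e / (1 + 2 * `|s| + 2 * `|t|).
have K0 : 0 < 1 + 2 * `|s| + 2 * `|t| by rewrite -addrA ltr_pwDl// addr_ge0// mulr_ge0.
have h0 : 0 < h by rewrite divr_gt0.
have [phi tphi uphi] := Hu _ h0; have [psi tpsi vpsi] := Hv _ h0.
exists (fun x => s * phi x + t * psi x); first exact: test_function_comb.
have [sq sqp] := test_function_sqint mO tphi.
have [sq' sqp'] := test_function_sqint mO tpsi.
have sqB (f g : V -> R) : sqint mu Omega f -> sqint mu Omega g -> sqint mu Omega (f \- g).
  move=> sf sg; have := sqint_comb mO 1 (-1) sf sg.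
  by congr sqint; apply/funext => x /=; rewrite mul1r mulN1r.
rewrite (H1_norm_ltE _ _ e0).
rewrite (H1_norm_ltE _ _ h0) in uphi.
rewrite (H1_norm_ltE _ _ h0) in vpsi.
apply: (le_lt_trans _ (H10_comb_bound e0 uphi vpsi)).
rewrite /H1_sqnorm !mulrDr !mulr_sumr addrACA -big_split /=.
apply: lerD; [|apply: ler_sum => i _].
- rewrite (le_trans _ (Rintegral_sqr_comb_le mO s t (sqB _ _ (H1_sqint u) sq)
     (sqB _ _ (H1_sqint v) sq')))// le_eqVlt; apply/orP; left; apply/eqP.
  by apply: eq_Rintegral => x _ /=; congr (_ ^+ 2); ring.
- rewrite (le_trans _ (Rintegral_sqr_comb_le mO s t (sqB _ _ (H1_grad_sqint u i) (sqp i))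
     (sqB _ _ (H1_grad_sqint v i) (sqp' i))))// le_eqVlt; apply/orP; left; apply/eqP.
  apply: eq_Rintegral => x _ /=; congr (_ ^+ 2).
  case: tphi tpsi => sphi _ _ [spsi _ _].
  by rewrite partial_comb//; ring.
Qed.

Lemma Rintegral_sqr_qform s t (f g : V -> R) : sqint mu Omega f -> sqint mu Omega g ->
  \int[mu]_(x in Omega) ((s * f x + t * g x) ^+ 2) =
  qform (\int[mu]_(x in Omega) (f x ^+ 2)) (\int[mu]_(x in Omega) (2 * f x * g x))
    (\int[mu]_(x in Omega) (g x ^+ 2)) s t.
Proof.
move=> sf sg; rewrite /qform -Rintegral_qform//; last 3 first.
- by case: sf.
- have := integrableZl mO 2 (sqint_mul mO sf sg).
  by apply: eq_integrable => // x _ /=; rewrite -EFinM mulrA.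
- by case: sg.
by apply: eq_Rintegral => x _; ring.
Qed.

(** The difference u - ((1 + s) u + t v) is - (s u + t v), whose squared H^1 norm is
    a quadratic form in (s, t), hence small near the origin. *)
Lemma H1_dist_small u v (e : R) : 0 < e -> exists2 d : R, 0 < d &
  forall s t, `|s| < d -> `|t| < d -> H1_dist u (H1_comb (1 + s) t u v) < e.
Proof.
move=> e0.
pose N f g := \int[mu]_(x in Omega) (2 * f x * g x : R).
have [d d0 small] := @qform_small R (H1_sqnorm u (H1_grad u))
  (N u v + \sum_i N (H1_grad u i) (H1_grad v i)) (H1_sqnorm v (H1_grad v)) (e ^+ 2)
  (exprn_gt0 2 e0).
exists d => // s t sd td; have := small _ _ sd td.
rewrite /H1_dist (H1_norm_ltE _ _ e0); congr (_ < _).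
have sq (f g : V -> R) : sqint mu Omega f -> sqint mu Omega g ->
  \int[mu]_(x in Omega) ((f x - ((1 + s) * f x + t * g x)) ^+ 2) =
  qform (\int[mu]_(x in Omega) (f x ^+ 2)) (N f g)
    (\int[mu]_(x in Omega) (g x ^+ 2)) s t.
  move=> sf sg; rewrite -Rintegral_sqr_qform//.
  by apply: eq_Rintegral => x _; ring.
rewrite /H1_sqnorm /= (sq _ _ (H1_sqint u) (H1_sqint v)).
rewrite (eq_bigr _ (fun i _ => sq _ _ (H1_grad_sqint u i) (H1_grad_sqint v i))).
by rewrite /qform !big_split /= -!mulr_suml; ring.
Qed.

End sobolev_space.

(** * The functional on the plane spanned by two functions *)

Section energy.
Context (R : realType) (n : nat).
Local Notation V := 'rV[R]_n.+1.
Local Notation mu := (lebesgue_Rn R n).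
Local Notation lam := (@lebesgue_outer R n).
Variables (Omega : set V).
Hypothesis mO : lam.-cara.-measurable Omega.
Variables (a : 'I_n.+1 -> 'I_n.+1 -> V -> R) (c : V -> R).
Hypothesis a_Loo : forall i j, LpOn +oo%E Omega (a i j).
Hypothesis c_Loo : LpOn +oo%E Omega c.
Implicit Types (u v w : H1 Omega) (s t : R).

Definition grad_form u v (x : V) : R :=
  \sum_(i < n.+1) \sum_(j < n.+1) a i j x * H1_grad u j x * H1_grad v i x.

Lemma grad_form_integrable u v : mu.-integrable Omega (EFin \o grad_form u v).
Proof.
apply: (integrable_rsum mO) => i; apply: (integrable_rsum mO) => j.
under eq_fun do rewrite -mulrA.
apply: (integrable_Lfuny_mul mO); first exact: a_Loo.
by apply: (sqint_mul mO); exact: H1_grad_sqint.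
Qed.

Lemma potential_integrable u v :
  mu.-integrable Omega (EFin \o (fun x => c x * (u x * v x))).
Proof.
apply: (integrable_Lfuny_mul mO c_Loo).
by apply: (sqint_mul mO); exact: H1_sqint.
Qed.

Definition energy u := \int[mu]_(x in Omega) grad_form u u x +
  \int[mu]_(x in Omega) (c x * (u x * u x)).

(** The coefficient of s t in the energy of s u + t v: the gradient form occurs with
    its arguments in both orders. *)
Definition cross_energy u v :=
  \int[mu]_(x in Omega) (grad_form u v x + grad_form v u x) +
  \int[mu]_(x in Omega) (2 * (c x * (u x * v x))).

Lemma energy_comb s t u v : energy (H1_comb mO s t u v) =
  qform (energy u) (cross_energy u v) (energy v) s t.
Proof.
have Iuv := integrableD mO (grad_form_integrable u v) (grad_form_integrable v u).
have Ic := integrableZl mO 2 (potential_integrable u v).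
have E1 := Rintegral_qform mO s t (grad_form_integrable u u) Iuv (grad_form_integrable v v).
have E2 := Rintegral_qform mO s t (potential_integrable u u) Ic (potential_integrable v v).
rewrite /energy [X in X + _](_ : _ = \int[mu]_(x in Omega) (grad_form u u x * s ^+ 2 +
  (grad_form u v x + grad_form v u x) * (s * t) + grad_form v v x * t ^+ 2)); last first.
  apply: eq_Rintegral => x _; rewrite /grad_form -big_split /= !mulr_suml -!big_split /=.
  apply: eq_bigr => i _; rewrite -big_split /= !mulr_suml -!big_split /=.
  by apply: eq_bigr => j _; ring.
rewrite [X in _ + X](_ : _ = \int[mu]_(x in Omega) (c x * (u x * u x) * s ^+ 2 +
  2 * (c x * (u x * v x)) * (s * t) + c x * (v x * v x) * t ^+ 2)); last first.
  by apply: eq_Rintegral => x _ /=; ring.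
by rewrite E1 E2 /qform /energy /cross_energy; ring.
Qed.

Lemma F_LE gamma u : F_L a c gamma u = 2^-1 * energy u
  + gamma / 2 * \int[mu]_(x in Omega) (u x ^+ 2)
  - gamma * Num.sqrt (\int[mu]_(x in Omega) (u x ^+ 2)).
Proof.
have N x : `|u x| ^+ 2 = u x ^+ 2 by rewrite real_normK// num_real.
have EN : \int[mu]_(x in Omega) (`|u x| ^+ 2) = \int[mu]_(x in Omega) (u x ^+ 2).
  by apply: eq_Rintegral => x _.
have EC : \int[mu]_(x in Omega) (c x * `|u x| ^+ 2) =
    \int[mu]_(x in Omega) (c x * (u x * u x)).
  by apply: eq_Rintegral => x _; rewrite N expr2.
rewrite /F_L /energy EN EC; congr (_ + _ - _).
by rewrite mulrDr.
Qed.

Lemma F_L_comb gamma s t u v : F_L a c gamma (H1_comb mO s t u v) =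
  planeJ gamma (energy u) (cross_energy u v) (energy v)
    (\int[mu]_(x in Omega) (u x ^+ 2)) (\int[mu]_(x in Omega) (2 * u x * v x))
    (\int[mu]_(x in Omega) (v x ^+ 2)) s t.
Proof.
rewrite F_LE energy_comb /planeJ.
by rewrite (Rintegral_sqr_qform mO s t (H1_sqint mO u) (H1_sqint mO v)).
Qed.

Lemma F_L_comb10 gamma u v : F_L a c gamma (H1_comb mO 1 0 u v) = F_L a c gamma u.
Proof.
have E (x y : R) : 1 * x + 0 * y = x by rewrite mul1r mul0r addr0.
have Ef : H1_comb mO 1 0 u v = u :> (V -> R) by apply/funext => x; exact: E.
have Eg : H1_grad (H1_comb mO 1 0 u v) = H1_grad u.
  by apply/funext => i; apply/funext => x; exact: E.
by rewrite /F_L Ef Eg.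
Qed.

Lemma F_L_comb01 gamma u v : F_L a c gamma (H1_comb mO 0 1 u v) = F_L a c gamma v.
Proof.
have E (x y : R) : 0 * x + 1 * y = y by rewrite mul1r mul0r add0r.
have Ef : H1_comb mO 0 1 u v = v :> (V -> R) by apply/funext => x; exact: E.
have Eg : H1_grad (H1_comb mO 0 1 u v) = H1_grad v.
  by apply/funext => i; apply/funext => x; exact: E.
by rewrite /F_L Ef Eg.
Qed.

Hypothesis c_ge0 : {ae mu, forall x, Omega x -> 0 <= c x}.
Hypothesis a_ge0 : {ae mu, forall x, Omega x -> forall xi : 'rV[R]_n.+1,
  0 <= \sum_(i < n.+1) \sum_(j < n.+1) a i j x * xi ord0 i * xi ord0 j}.

Lemma energy_ge0 u : 0 <= energy u.
Proof.
apply: addr_ge0; apply: (Rintegral_ae_ge0 mO).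
- exact: grad_form_integrable.
- apply: ae_imply_on a_ge0 => x Ox /(_ (\row_i H1_grad u i x)).
  congr (_ <= _); apply: eq_bigr => i _; apply: eq_bigr => j _.
  by rewrite !mxE; ring.
- exact: potential_integrable.
- apply: ae_imply_on c_ge0 => x Ox cx.
  by rewrite mulr_ge0// -expr2 sqr_ge0.
Qed.

End energy.

Theorem theorem5 (R : realType) (n : nat) (Omega : set 'rV[R]_n.+1)
    (Omega_open : open Omega) (Omega_bounded : bounded_set Omega)
    (Omega_lipschitz : lipschitz_boundary Omega)
    (a : 'I_n.+1 -> 'I_n.+1 -> 'rV[R]_n.+1 -> R) (c : 'rV[R]_n.+1 -> R)
    (a_Loo : forall i j, LpOn +oo%E Omega (a i j))
    (c_Loo : LpOn +oo%E Omega c)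
    (a_sym : forall i j,
      {ae lebesgue_Rn R n, forall x, Omega x -> a i j x = a j i x})
    (c_ge0 : {ae lebesgue_Rn R n, forall x, Omega x -> 0 <= c x})
    (alpha beta : R) (alpha_gt0 : 0 < alpha) (alpha_le_beta : alpha <= beta)
    (a_elliptic : {ae lebesgue_Rn R n, forall x, Omega x ->
      forall xi : 'rV[R]_n.+1,
        alpha * (\sum_(i < n.+1) xi ord0 i ^+ 2) <=
          \sum_(i < n.+1) \sum_(j < n.+1) a i j x * xi ord0 i * xi ord0 j /\
        \sum_(i < n.+1) \sum_(j < n.+1) a i j x * xi ord0 i * xi ord0 j <=
          beta * (\sum_(i < n.+1) xi ord0 i ^+ 2)})
    (gamma : R) (gamma_gt0 : 0 < gamma) (u : H1 Omega) :
  local_minimizer (F_L a c gamma) u -> global_minimizer (F_L a c gamma) u.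
Proof.
move=> [Hu [e e0 umin]]; split => // v Hv.
have mO := open_measurable_Rn Omega_open.
have a_ge0 : {ae lebesgue_Rn R n, forall x, Omega x -> forall xi : 'rV[R]_n.+1,
    0 <= \sum_(i < n.+1) \sum_(j < n.+1) a i j x * xi ord0 i * xi ord0 j}.
  apply: ae_imply_on a_elliptic => x Ox ell xi; have [+ _] := ell xi.
  apply: le_trans; apply: mulr_ge0; first exact: ltW.
  by apply: sumr_ge0 => i _; exact: sqr_ge0.
rewrite -(F_L_comb10 mO a c gamma u v) -(F_L_comb01 mO a c gamma u v).
have [d d0 near_u] := H1_dist_small mO u v e0.
rewrite !(F_L_comb mO a_Loo c_Loo).
apply: (plane_local_min_global gamma_gt0 d0) => [s t|s t|s t sd td].
- by rewrite -(energy_comb mO a_Loo c_Loo); exact: energy_ge0.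
- rewrite -(Rintegral_sqr_qform mO s t (H1_sqint mO u) (H1_sqint mO v)).
  by apply: Rintegral_ge0 => x _; exact: sqr_ge0.
rewrite -!(F_L_comb mO a_Loo c_Loo) F_L_comb10.
by apply: umin; [exact: H10_comb|exact: near_u].
Qed.
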